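(* Let $(G,\tau)$ and $(H,\sigma)$ be topological groups, $N$ a subgroup of $H$, $M$ a subgroup of $G$ and $f:(G,\tau)\to(H,\sigma)$ a continuous surjective homomorphism. (a) If $f$ is A-open, then $f\restriction_{f^{-1}(N)}:(f^{-1}(N),\tau\restriction_{f^{-1}(N)})\to(N,\sigma\restriction_N)$ is A-open. (b) If $f$ is A$^*$-open, then $f\restriction_{f^{-1}(N)}:(f^{-1}(N),\tau\restriction_{f^{-1}(N)})\to(N,\sigma\restriction_N)$ is A$^*$-open. (c) If $f$ is strongly A$^*$-open, then $f\restriction_{f^{-1}(N)}:(f^{-1}(N),\tau\restriction_{f^{-1}(N)})\to(N,\sigma\restriction_N)$ is strongly A$^*$-open. (d) If $f$ is strongly A-open, then $f\restriction_M:(M,\tau\restriction_M)\to(f(M),\sigma\restriction_{f(M)})$ is strongly A-open.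
   Context: Topological groups are not assumed Hausdorff. $\mathcal V_{(G,\tau)}(e_G)$ is the filter of all neighborhoods of $e_G$ in $(G,\tau)$. For a neighborhood $U$ of $e_G$, a subset $M\subseteq G$ is $U$-thin if $\bigcap\{x^{-1}Ux:x\in M\}$ is a neighborhood of $e_G$. Write $[x,y]=xyx^{-1}y^{-1}$ and, for $g\in G$ and $K\subseteq G$, $[g,K]=\{[g,k]:k\in K\}$. A section of a surjective homomorphism $f:G\to H$ is an injective function $s:H\to G$ such that $f(s(h))=h$ for every $h\in H$ and $s(e_H)=e_G$ (no continuity required). A map $t:H\to G$ between topological groups is a quasihomomorphism if $t(e_H)=e_G$, the map $t':H\times H\to G$, $t'(h_1,h_2)=t(h_1)t(h_2)t(h_1h_2)^{-1}$, is continuous at $(e_H,e_H)$, and for every $y\in H$ the map $t_y:H\to G$, $t_y(h)=t(y)t(h)t(y)^{-1}t(yhy^{-1})^{-1}$, is continuous at $e_H$. Let $f:(G,\tau)\to(H,\sigma)$ be a surjective homomorphism. - $f$ is A-open if for every $U\in\mathcal V_{(G,\tau)}(e_G)$ there exists $V\in\mathcal V_{(H,\sigma)}(e_H)$ such that $f^{-1}(V)$ is $f^{-1}(f(U))$-thin, and for every $g\in G$ there exists $V_g\in\mathcal V_{(H,\sigma)}(e_H)$ such that $[g,f^{-1}(V_g)]\subseteq f^{-1}(f(U))$. - $f$ is A$^*$-open if there exists a section $s$ of $f$ such that for every $U\in\mathcal V_{(G,\tau)}(e_G)$ there exists $V\in\mathcal V_{(H,\sigma)}(e_H)$ such that $s(V)$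 is $U$-thin, and for every $g\in G$ there exists $V_g\in\mathcal V_{(H,\sigma)}(e_H)$ such that $[g,s(V_g)]\subseteq U$; if such an $s$ can be chosen to be also a quasihomomorphism, $f$ is strongly A$^*$-open. - $f$ is strongly A-open if for every $U\in\mathcal V_{(G,\tau)}(e_G)$ there exists $V\in\mathcal V_{(H,\sigma)}(e_H)$ such that $f^{-1}(V)$ is $U$-thin, and for every $g\in G$ there exists $V_g\in\mathcal V_{(H,\sigma)}(e_H)$ such that $[g,f^{-1}(V_g)]\subseteq U$. *)

(* Defs.v *)
From HB Require Import structures.
From mathcomp Require Import all_boot.
From mathcomp Require Import all_classical topology.

Set Implicit Arguments.
Unset Strict Implicit.
Unset Printing Implicit Defensive.

Local Open Scope classical_set_scope.
Local Open Scope group_scope.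

HB.mixin Record isTopologicalGroup G & Topological G & Group G := {
  mulg_continuous : continuous (fun p : G * G => p.1 * p.2);
  invg_continuous : continuous (fun x : G => x^-1)
}.

#[short(type="topologicalGroupType")]
HB.structure Definition TopologicalGroup :=
  {G of Topological G & Group G & isTopologicalGroup G}.

Record subgroup (G : groupType) := Subgroup {
  subgroup_set :> set G;
  subgroup_closed : group_closed [in subgroup_set]
}.

(* A subgroup [N], seen as a type through the coercion [set_type], carries the
   induced group structure; MathComp-Analysis already equips [set_type] with
   the initial topology of the inclusion, i.e. the subspace topology. *)
HB.instance Definition _ (G : groupType) (N : subgroup G) :=
  SubChoice.copy (set_type (subgroup_set N)) {x | x \in subgroup_set N}.
HB.instance Definition _ (G : groupType) (N : subgroup G) :=
  SubChoice_isSubGroup.Build G [in subgroup_set N] (set_type (subgroup_set N))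
    (subgroup_closed N).

Section TopologicalSubgroup.
Variables (G : topologicalGroupType) (N : subgroup G).

Fact subgroup_mulg_continuous : continuous (fun p : N * N => p.1 * p.2).
Proof.
apply/continuousP => _ [A Aop <-].
rewrite (_ : _ @^-1` _ = (fun p : N * N => (val p.1 : G) * val p.2) @^-1` A) //.
move: A Aop; apply/continuousP => p.
apply: (@continuous_comp _ _ _ (fun p : N * N => (val p.1 : G, val p.2 : G))
  (fun q : G * G => q.1 * q.2)); last exact: mulg_continuous.
apply: cvg_pair => /=.
  apply: (@continuous_comp _ _ _ fst (val : N -> G)); first exact: cvg_fst.
  exact: initial_continuous.
apply: (@continuous_comp _ _ _ snd (val : N -> G)); first exact: cvg_snd.
exact: initial_continuous.
Qed.

Fact subgroup_invg_continuous : continuous (fun x : N => x^-1).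
Proof.
apply/continuousP => _ [A Aop <-].
rewrite (_ : _ @^-1` _ = (fun x : N => (val x : G)^-1) @^-1` A) //.
move: A Aop; apply/continuousP => x.
apply: (@continuous_comp _ _ _ (val : N -> G) (fun y : G => y^-1)).
  exact: initial_continuous.
exact: invg_continuous.
Qed.

HB.instance Definition _ := isTopologicalGroup.Build (set_type (subgroup_set N))
  subgroup_mulg_continuous subgroup_invg_continuous.
End TopologicalSubgroup.

Section Restrictions.
Variables (G H : groupType) (f : {multiplicative G -> H}).

Fact mult1 : f 1 = 1.
Proof. by apply: (@mulgI _ (f 1)); rewrite -gmulfM !mulg1. Qed.

Fact multF x y : f (x / y) = f x / f y.
Proof. by apply: (@mulIg _ (f y)); rewrite -gmulfM !mulgVK. Qed.

Fact preimage_closed (N : subgroup H) : group_closed [in f @^-1` N].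
Proof.
have [N1 NF] := subgroup_closed N; split=> [|x y]; rewrite !inE /=.
  by move: N1; rewrite inE mult1.
by move=> /mem_set Nx /mem_set Ny; rewrite multF; apply/set_mem/NF.
Qed.

Definition preimage_subgroup (N : subgroup H) : subgroup G :=
  Subgroup (preimage_closed N).

Fact image_closed (M : subgroup G) : group_closed [in f @` M].
Proof.
have [M1 MF] := subgroup_closed M; split=> [|x y]; rewrite !inE /=.
  by exists 1; rewrite ?mult1 //; apply/set_mem.
move=> [a /mem_set Ma <-] [b /mem_set Mb <-].
by exists (a / b); rewrite ?multF //; apply/set_mem/MF.
Qed.

Definition image_subgroup (M : subgroup G) : subgroup H :=
  Subgroup (image_closed M).

Definition restrict (K : subgroup G) (L : subgroup H)
    (fKL : set_fun K L f) (x : K) : L :=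
  SigSub (mem_set (fKL _ (set_valP x))).

Fact restrictM (K : subgroup G) (L : subgroup H) (fKL : set_fun K L f) :
  {morph restrict fKL : x y / x * y}.
Proof. by move=> x y; apply: val_inj; rewrite /= gmulfM. Qed.

HB.instance Definition _ (K : subgroup G) (L : subgroup H)
    (fKL : set_fun K L f) :=
  isMultiplicative.Build (set_type K) (set_type L) (restrict fKL)
    (restrictM fKL).

Fact preimage_set_fun (N : subgroup H) : set_fun (preimage_subgroup N) N f.
Proof. by []. Qed.

Fact image_set_fun (M : subgroup G) : set_fun M (image_subgroup M) f.
Proof. by move=> x Mx; exists x. Qed.

Definition restrict_preimage (N : subgroup H) :
    {multiplicative preimage_subgroup N -> N} :=
  restrict (@preimage_set_fun N).

Definition restrict_image (M : subgroup G) :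
    {multiplicative M -> image_subgroup M} :=
  restrict (@image_set_fun M).

Lemma restrict_preimage_surj (N : subgroup H) :
  set_surj [set: G] [set: H] f -> set_surj setT setT (restrict_preimage N).
Proof.
move=> fsurj h _; have [x _ fx] := fsurj (val h) I.
have Nx : x \in f @^-1` N by rewrite inE /= fx; apply: set_valP.
by exists (SigSub Nx) => //; apply: val_inj.
Qed.

Lemma restrict_image_surj (M : subgroup G) :
  set_surj setT setT (restrict_image M).
Proof.
move=> [h hM] _; have [x Mx fx] := set_mem hM.
by exists (SigSub (mem_set Mx)) => //; apply: val_inj.
Qed.

End Restrictions.

(* MathComp's [~ x, y] is x^-1 * y^-1 * x * y; the convention needed here is
   x * y * x^-1 * y^-1. *)
Definition comm (G : groupType) (x y : G) : G := x * y * x^-1 * y^-1.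

Definition thin (G : topologicalGroupType) (U M : set G) : Prop :=
  nbhs (1 : G) (\bigcap_(x in M) [set x^-1 * u * x | u in U]).

Section Openness.
Variables (G H : topologicalGroupType) (f : {multiplicative G -> H}).

Definition is_section (s : H -> G) : Prop :=
  [/\ injective s, forall h, f (s h) = h & s 1 = 1].

Definition quasihomomorphism (t : H -> G) : Prop :=
  [/\ t 1 = 1,
      {for (1, 1) : H * H,
        continuous (fun p : H * H => t p.1 * t p.2 * (t (p.1 * p.2))^-1)} &
      forall y : H,
        {for (1 : H), continuous (fun h : H =>
           t y * t h * (t y)^-1 * (t (y * h * y^-1))^-1)}].

(* The four notions below are meant for a surjective [f]. *)

Definition A_open : Prop :=
  forall U : set G, nbhs 1 U ->
    (exists2 V : set H, nbhs 1 V & thin (f @^-1` (f @` U)) (f @^-1` V)) /\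
    (forall g : G, exists2 Vg : set H, nbhs 1 Vg &
       comm g @` (f @^-1` Vg) `<=` f @^-1` (f @` U)).

Definition Astar_open_for (s : H -> G) : Prop :=
  forall U : set G, nbhs 1 U ->
    (exists2 V : set H, nbhs 1 V & thin U (s @` V)) /\
    (forall g : G, exists2 Vg : set H, nbhs 1 Vg & comm g @` (s @` Vg) `<=` U).

Definition Astar_open : Prop :=
  exists2 s : H -> G, is_section s & Astar_open_for s.

Definition strongly_Astar_open : Prop :=
  exists s : H -> G,
    [/\ is_section s, quasihomomorphism s & Astar_open_for s].

Definition strongly_A_open : Prop :=
  forall U : set G, nbhs 1 U ->
    (exists2 V : set H, nbhs 1 V & thin U (f @^-1` V)) /\
    (forall g : G, exists2 Vg : set H, nbhs 1 Vg &
       comm g @` (f @^-1` Vg) `<=` U).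

End Openness.

(* Main.v *)
Require Import Defs.
From HB Require Import structures.
From mathcomp Require Import all_boot.
From mathcomp Require Import all_classical topology.

(** Every openness notion at stake asks that [f], seen through some monotone
    assignment [P] from neighborhoods in [H] to subsets of [G] (the preimage
    under [f], or the image under a section), satisfies one and the same
    two-part smallness condition relative to a target set [T]: the sets [P V]
    are eventually [T]-thin, and eventually commute modulo [T] with each fixed
    element. That condition is inherited by subgroups ([near_central_subgroup]),
    for two reasons: neighborhoods of the identity in a subgroup are traces of
    neighborhoods in the whole group, and conjugates and commutators of
    elements of a subgroup remain in it, so that both can be formed inside it.

    It remains to see that the target sets and the assignments are compatible
    with traces. For A-openness this uses that the subgroup is the full preimage
    of [N]: a point of [N] lying in [f @` W] has all its [f]-preimages in the
    subgroup, so [f @` (W `&` f @^-1` N)] is [f @` W `&` N]. For the starred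
    notions it is again the full preimage that lets a section of [f] restrict
    to a section over [N], and the defect maps of the restricted section are
    restrictions of the original ones. For strong A-openness the target is the
    neighborhood itself, and an arbitrary subgroup of [G] will do. *)

Set Implicit Arguments.
Unset Strict Implicit.
Unset Printing Implicit Defensive.

Local Open Scope classical_set_scope.
Local Open Scope group_scope.

(** * Traces on subgroups *)

Section SubgroupTopology.
Variables (G : topologicalGroupType) (K : subgroup G).

Lemma nbhs1_val_preimage (W : set G) :
  nbhs 1 W -> nbhs (1 : K) ((val : K -> G) @^-1` W).
Proof. exact: (@initial_continuous K G val 1). Qed.

Lemma nbhs1_subgroupP (U : set K) : nbhs (1 : K) U ->
  exists2 W : set G, nbhs 1 W & (val : K -> G) @^-1` W `<=` U.
Proof.
rewrite nbhsE => -[_ [[A Aop <-] A1] AU].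
by exists A => //; apply: open_nbhs_nbhs.
Qed.

(** Continuity into a subgroup is tested after inclusion, because the subspace
    topology is the initial one. *)
Lemma cvg_subgroup (T : Type) (F : set_system T) (u : T -> K) (l : K) :
  Filter F -> (val (u x) : G) @[x --> F] --> (val l : G) -> u @ F --> l.
Proof.
move=> FF ul A; rewrite nbhsE => -[_ [[B Bop <-] Bl] BA].
by apply: filterS BA _; apply: ul; apply: open_nbhs_nbhs.
Qed.

End SubgroupTopology.

(** * The smallness condition shared by all openness notions *)

(** The common shape of all the openness conditions: along the neighborhood
    filter of [H], the sets [P V] become uniformly tame for conjugation, and
    asymptotically central, modulo [T]. *)
Definition near_central (G H : topologicalGroupType) (P : set H -> set G)
    (T : set G) : Prop :=
  (exists2 V : set H, nbhs 1 V & thin T (P V)) /\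
  (forall g : G, exists2 Vg : set H, nbhs 1 Vg & comm g @` (P Vg) `<=` T).

Section NearCentralSubgroup.
Variables (G H : topologicalGroupType) (K : subgroup G) (L : subgroup H).

(** If [z] in [K] equals [x^-1 * t * x] with [x] in [K], then
    [t = x * z * x^-1] is in [K] too. *)
Lemma thin_subgroup (T A : set G) (U B : set K) :
  (val : K -> G) @^-1` T `<=` U -> (val : K -> G) @` B `<=` A ->
  thin T A -> thin U B.
Proof.
move=> TU BA /(@nbhs1_val_preimage G K); apply: filterS => z Tz x Bx.
have [|t Tt tz] := Tz (val x); first by apply: BA; exists x.
exists (x * z * x^-1); last by rewrite !mulgA mulVg mul1g mulgVK.
by apply: TU; rewrite /= -tz !mulgA mulgV mul1g mulgK.
Qed.

Lemma near_central_subgroup (P : set H -> set G) (Q : set L -> set K)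
    (T : set G) (U : set K) :
  (val : K -> G) @^-1` T `<=` U ->
  (forall V, (val : K -> G) @` Q ((val : L -> H) @^-1` V) `<=` P V) ->
  near_central P T -> near_central Q U.
Proof.
move=> TU QP [[V V1 VT] PT]; split=> [|g].
  exists ((val : L -> H) @^-1` V); first exact: nbhs1_val_preimage.
  exact: thin_subgroup (QP V) VT.
have [W W1 WT] := PT (val g).
exists ((val : L -> H) @^-1` W); first exact: nbhs1_val_preimage.
move=> _ [x Qx <-]; apply: TU; apply: WT.
by exists (val x) => //; apply: QP; exists x.
Qed.

End NearCentralSubgroup.

(** * Restricting the openness notions *)

Section RestrictOpenness.
Variables (G H : topologicalGroupType) (f : {multiplicative G -> H}).

Lemma restrict_preimage_A_open (N : subgroup H) :
  A_open f -> A_open (restrict_preimage f N).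
Proof.
move=> fA U /nbhs1_subgroupP[W W1 WU].
apply: (@near_central_subgroup _ _ _ _ (preimage f) _ _ _ _ _ (fA W W1)).
  move=> x [w Ww fwx].
  (* The witness [w] is only known to lie in [G]; its image is that of [x],
     hence in [N]. *)
  have Nw : w \in f @^-1` N by rewrite inE /= fwx; apply: (set_valP x).
  by exists (SigSub Nw); [apply: WU | apply: val_inj].
by move=> V _ [x Vx <-].
Qed.

Lemma restrict_image_strongly_A_open (M : subgroup G) :
  strongly_A_open f -> strongly_A_open (restrict_image f M).
Proof.
move=> fA U /nbhs1_subgroupP[W W1 WU].
apply: (@near_central_subgroup _ _ _ _ (preimage f) _ _ _ WU _ (fA W W1)).
by move=> V _ [x Vx <-].
Qed.

Section RestrictSection.
Variables (N : subgroup H) (s : H -> G) (fs : is_section f s).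

Fact section_preimage (h : N) : s (val h) \in f @^-1` N.
Proof. by case: fs => _ sK _; rewrite inE /= sK; apply: set_valP. Qed.

Definition restrict_section (h : N) : preimage_subgroup f N :=
  SigSub (section_preimage h).

Lemma restrict_section_is_section :
  is_section (restrict_preimage f N) restrict_section.
Proof.
have [sI sK s1] := fs; split=> [h k /(congr1 val) /sI /val_inj //|h|].
  by apply: val_inj; apply: sK.
by apply: val_inj; apply: s1.
Qed.

Lemma restrict_section_Astar_open_for :
  Astar_open_for s -> Astar_open_for restrict_section.
Proof.
move=> sA U /nbhs1_subgroupP[W W1 WU].
apply: (@near_central_subgroup _ _ _ _ (image^~ s) _ _ _ WU _ (sA W W1)).
by move=> V _ [_ [h Vh <-] <-]; exists (val h).
Qed.

Lemma restrict_section_quasihomomorphism :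
  quasihomomorphism s -> quasihomomorphism restrict_section.
Proof.
move=> [s1 sM sJ]; split=> [||y].
- by apply: val_inj; apply: s1.
- apply: cvg_subgroup.
  have valC : continuous (fun p : N * N => (val p.1 : H, val p.2 : H)).
    move=> p; apply: cvg_pair => /=.
      apply: (@continuous_comp _ _ _ fst (val : N -> H)); first exact: cvg_fst.
      exact: initial_continuous.
    apply: (@continuous_comp _ _ _ snd (val : N -> H)); first exact: cvg_snd.
    exact: initial_continuous.
  apply: (@continuous_comp _ _ _ (fun p : N * N => (val p.1 : H, val p.2 : H))
    (fun p : H * H => s p.1 * s p.2 * (s (p.1 * p.2))^-1)); first exact: valC.
  exact: sM.
- apply: cvg_subgroup; first exact: (@nbhs_filter N 1).
  apply: (@continuous_comp _ _ _ (val : N -> H) (fun h : H =>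
    s (val y) * s h * (s (val y))^-1 * (s (val y * h * (val y)^-1))^-1)).
    exact: initial_continuous.
  exact: sJ.
Qed.

End RestrictSection.

End RestrictOpenness.

Theorem theorem6p1 (G H : topologicalGroupType) (N : subgroup H)
    (M : subgroup G) (f : {multiplicative G -> H})
    (f_continuous : continuous f)
    (f_surjective : set_surj [set: G] [set: H] f) :
  [/\ A_open f -> A_open (restrict_preimage f N),
      Astar_open f -> Astar_open (restrict_preimage f N),
      strongly_Astar_open f -> strongly_Astar_open (restrict_preimage f N) &
      strongly_A_open f -> strongly_A_open (restrict_image f M)].
Proof.
split.
- exact: restrict_preimage_A_open.
- move=> [s fs sA]; exists (@restrict_section _ _ f N s fs).
    exact: restrict_section_is_section.
  exact: restrict_section_Astar_open_for.
- move=> [s [fs sq sA]]; exists (@restrict_section _ _ f N s fs); split.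
  + exact: restrict_section_is_section.
  + exact: restrict_section_quasihomomorphism.
  + exact: restrict_section_Astar_open_for.
- exact: restrict_image_strongly_A_open.
Qed.
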